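(* Let $q=p^m$ be a prime power, let $n$ be a positive integer and let $1\le k\le\lfloor\frac{n}{q+1}\rfloor$. Assume that one of the following conditions holds: 1) $(n-1)\mid(q^2-1)$; 2) $n=tq$ with $1\le t\le q-1$; 3) $n=(t+1)N+1$, where $N\mid(q^2-1)$, $n_2=\frac{N}{\gcd(N,q+1)}$ and $1\le t\le\frac{q-1}{n_2}-2$. Then, for any $0\le r\le k-1$, there exists a linear code $C$ with parameters $[n,k,\ge n-k]_{q^2}$ such that $0\le\dim \mathrm{Hull}_H(C)\le k-r$.
   Context: An $[n,k,d]_{q^2}$ code is a linear code over $\mathbb{F}_{q^2}$ of length $n$, dimension $k$ and minimum Hamming distance $d$; $[n,k,\ge d_0]_{q^2}$ means that the minimum distance is at least $d_0$. The Hermitian inner product on $\mathbb{F}_{q^2}^n$ is $\langle x,y\rangle_H=\sum_i x_iy_i^q$, $C^{\perp_H}$ is the dual of $C$ with respect to it, and the Hermitian hull is $\mathrm{Hull}_H(C)=C\cap C^{\perp_H}$. The letters $n,k,r,t,N$ denote integers, $N\geq 1$. *)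

(* Defs.v *)
From HB Require Import structures.
From mathcomp Require Import all_boot all_order all_algebra all_field.

Set Implicit Arguments.
Unset Strict Implicit.
Unset Printing Implicit Defensive.

Import GRing.Theory.
Local Open Scope ring_scope.

Section HermitianCodes.

Variables (F : finFieldType) (n : nat).
Implicit Types (C : {vspace 'rV[F]_n}) (x y : 'rV[F]_n).

Definition hamming_dist x y : nat := #|[set i : 'I_n | x 0 i != y 0 i]|.

(* A relation rather than a function, so that the zero code, which has no two
   distinct codewords, is not given a conventional minimum distance. *)
Definition is_min_dist C (d : nat) : Prop :=
  (exists x y, [/\ x \in C, y \in C, x != y & hamming_dist x y = d]) /\
  (forall x y, x \in C -> y \in C -> x != y -> (d <= hamming_dist x y)%N).

(* An [n, k, d] code over F. *)
Definition is_code C (k d : nat) : Prop := \dim C = k /\ is_min_dist C d.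

(* The Hermitian product when #|F| = q ^ 2.  The type F^o (F as a vector space
   over itself) lets hprodr q y = <_, y>_H be packaged as a linear map. *)
Definition hprod (q : nat) x y : F^o := \sum_(i < n) x 0 i * y 0 i ^+ q.
Definition hprodr (q : nat) y x : F^o := hprod q x y.

Lemma hprodr_is_linear q y : linear (hprodr q y).
Proof.
move=> a u v; rewrite /hprodr /hprod scaler_sumr -big_split /=.
by apply: eq_bigr => i _; rewrite !mxE mulrDl scalerAl.
Qed.

HB.instance Definition _ q y :=
  GRing.isLinear.Build F 'rV[F]_n F^o _ (hprodr q y) (hprodr_is_linear q y).

Definition hdual (q : nat) C : {vspace 'rV[F]_n} :=
  (\bigcap_(y in C) lker (linfun (hprodr q y)))%VS.

Lemma mem_hdual q C x :
  reflect (forall y, y \in C -> hprod q x y = 0) (x \in hdual q C).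
Proof.
rewrite memvE; apply: (iffP subv_bigcapP) => h y Cy.
  by have := h y Cy; rewrite -memvE memv_ker lfunE => /eqP.
by rewrite -memvE memv_ker lfunE; apply/eqP/h.
Qed.

Definition hhull (q : nat) C : {vspace 'rV[F]_n} := (C :&: hdual q C)%VS.

End HermitianCodes.

(* Main.v *)
(** Every admissible [n] satisfies [n <= q ^ 2], so generalized Reed-Solomon
codes of length [n] exist; they are MDS for every choice of nonzero column
multipliers [v].  The Hermitian Gram matrix is
[V1 D1 W1^T + V2 D2 W2^T], where the [V]'s and [W]'s are Vandermonde at the
points [a_j] and [a_j ^ q], and [D1], [D2] carry the [v_j ^ (q + 1)].  Since [V1]
and [W1] are square and invertible, and a determinant is affine in each
diagonal entry, two distinct nonzero values of [v_j ^ (q + 1)] are enough to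
make it invertible, and then the hull is zero.  Two such values exist unless
[q = 2]; in that case [k = 1] and the bound on the hull is trivial. *)

Require Import Defs.
From mathcomp Require Import all_boot all_order all_algebra all_field.
From mathcomp Require Import zify.

Set Implicit Arguments.
Unset Strict Implicit.
Unset Printing Implicit Defensive.

Import GRing.Theory.

Section ReedSolomon.

Local Open Scope ring_scope.

(** Induction on the size: expanding along row 0, the determinant is affine in the first diagonal
    entry, with slope the minor made nonzero by the induction hypothesis. Such a function cannot
    vanish at both [x] and [y]. *)
Lemma exists_det_add_diag_neq0 (F : fieldType) (x y : F) k (M : 'M[F]_k) :
  x != y ->
  exists2 d : 'rV_k, forall i, d 0 i \in [:: x; y] & \det (M + diag_mx d) != 0.
Proof.
move=> neq_xy; elim: k M => [|k IHk] M.
  by exists 0 => [[]//|]; rewrite det_mx00 oner_eq0.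
have [d d_xy det_d] := IHk (row' 0 (col' 0 M)).
pose ext z : 'rV_k.+1 := \row_i oapp (d 0) z (unlift 0 i).
have ext_xy z : z \in [:: x; y] -> forall i, ext z 0 i \in [:: x; y].
  by move=> z_xy i; rewrite mxE; case: unliftP => [j|] _ /=.
(* Cofactors along row 0 delete that row, the only one containing [z]. *)
have cofE z j : cofactor (M + diag_mx (ext z)) 0 j
              = cofactor (M + diag_mx (ext 0)) 0 j.
  rewrite /cofactor; congr (_ * \det _); apply/matrixP=> i l.
  by rewrite !mxE liftK.
have cof0 : cofactor (M + diag_mx (ext 0)) 0 0 = \det (row' 0 (col' 0 M) + diag_mx d).
  rewrite /cofactor addn0 expr0 mul1r; congr (\det _); apply/matrixP=> i l.
  by rewrite !mxE liftK /= (inj_eq lift_inj).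
have detE z : \det (M + diag_mx (ext z))
    = z * \det (row' 0 (col' 0 M) + diag_mx d) + \det (M + diag_mx (ext 0)).
  rewrite (expand_det_row _ 0) [in RHS](expand_det_row _ 0) !big_ord_recl.
  rewrite !cofE cof0 !mxE unlift_none /= addr0 mulr1n mulrDl.
  rewrite (addrC (M 0 0 * _)) -addrA; congr (_ + (_ + _)).
  apply: eq_bigr => i _.
  by rewrite cofE !mxE.
have [detx0|] := eqVneq (\det (M + diag_mx (ext x))) 0; last first.
  by exists (ext x) => //; apply: ext_xy; rewrite mem_head.
exists (ext y); first by apply: ext_xy; rewrite !inE eqxx orbT.
apply: contra_neq neq_xy => dety0; apply: (mulIf det_d).
by apply: (addIr (\det (M + diag_mx (ext 0)))); rewrite -!detE detx0.
Qed.

Lemma unitmx_Vandermonde (F : fieldType) k (a : 'rV[F]_k) :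
  injective (a 0) -> Vandermonde k a \in unitmx.
Proof.
move=> a_inj; rewrite unitmxE det_Vandermonde unitfE.
apply/prodf_neq0 => i _; apply/prodf_neq0 => j lt_ij.
by rewrite subr_eq0 (inj_eq a_inj) neq_ltn lt_ij orbT.
Qed.

Variable F : finFieldType.

Definition grs_mx k n (a v : 'rV[F]_n) : 'M[F]_(k, n) :=
  Vandermonde k a *m diag_mx v.

Definition mx_code k n (G : 'M[F]_(k, n)) : {vspace 'rV[F]_n} :=
  limg (linfun (mulmxr G)).

Lemma mx_codeP k n (G : 'M[F]_(k, n)) x :
  reflect (exists c, x = c *m G) (x \in mx_code G).
Proof.
apply: (iffP memv_imgP) => [[c _ ->]|[c ->]]; exists c; rewrite ?lfunE //=.
exact: memvf.
Qed.

Lemma dim_mx_code k n (G : 'M[F]_(k, n)) :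
  (forall c : 'rV_k, c *m G = 0 -> c = 0) -> \dim (mx_code G) = k.
Proof.
move=> G_inj; rewrite /mx_code limg_dim_eq ?dimvf /dim /= ?mul1n //.
apply/eqP; rewrite capfv -subv0; apply/subvP=> c.
by rewrite memv_ker lfunE /= memv0 => /eqP/G_inj ->.
Qed.

(** Up to nonzero factors, a codeword lists the values at distinct points of a nonzero polynomial of
    size at most [k], so fewer than [k] entries vanish. *)
Lemma grs_weight k n (a v : 'rV[F]_n) (c : 'rV[F]_k) :
    injective (a 0) -> (forall j, v 0 j != 0) -> c != 0 ->
  (n < k + #|[set j | ((c *m grs_mx k a v) 0 j != 0)%R]|)%N.
Proof.
move=> a_inj v_neq0 c_neq0; set Z := [set j | _].
have p_neq0 : rVpoly c != 0.
  by apply: contra_neq c_neq0 => p0; rewrite -[c]rVpolyK p0 linear0.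
have evalE j : (c *m grs_mx k a v) 0 j = (rVpoly c).[a 0 j] * v 0 j.
  rewrite mulmxA mul_mx_diag !mxE; congr (_ * _).
  rewrite (horner_coef_wide _ (size_poly _ _)); apply: eq_bigr => i _.
  by rewrite coef_rVpoly_ord mxE.
have /max_poly_roots : all (root (rVpoly c)) [seq a 0 j | j <- enum (~: Z)].
  apply/allP=> _ /mapP[j + ->]; rewrite mem_enum !inE negbK evalE.
  by rewrite mulf_eq0 (negPf (v_neq0 j)) orbF.
rewrite map_inj_uniq ?enum_uniq // size_map -cardE => /(_ p_neq0 isT) ltZ.
have := leq_trans ltZ (size_poly _ _); rewrite cardsCs setCK card_ord.
by have := max_card (mem Z); rewrite card_ord; lia.
Qed.

Lemma is_min_dist_exists n (C : {vspace 'rV[F]_n}) w :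
    (0 < \dim C)%N ->
    (forall x, x \in C -> x != 0 -> (w <= #|[set j | (x 0 j != 0)%R]|)%N) ->
  exists2 d, is_min_dist C d & (w <= d)%N.
Proof.
move=> C_gt0 wtC; pose wt (x : 'rV[F]_n) := #|[set j | (x 0 j != 0)%R]|.
have distE x y : hamming_dist x y = wt (x - y).
  by apply: eq_card => j; rewrite !inE !mxE subr_eq0.
have Cv : (vpick C \in C) && (vpick C != 0).
  by rewrite memv_pick vpick0 -dimv_eq0 -lt0n.
case: (@arg_minnP _ _ [pred x | (x \in C) && (x != 0)] wt Cv) => x /andP[Cx x0] min_x.
exists (wt x); last exact: wtC.
split=> [|y z Cy Cz neq_yz].
  by exists x, 0; rewrite mem0v distE subr0.
by rewrite distE; apply: min_x; rewrite /= memvB ?subr_eq0.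
Qed.

Lemma grs_is_code k n (a v : 'rV[F]_n) :
    (0 < k <= n)%N -> injective (a 0) -> (forall j, v 0 j != 0) ->
  exists2 d, is_code (mx_code (grs_mx k a v)) k d & (n - k <= d)%N.
Proof.
move=> /andP[k_gt0 le_kn] a_inj v_neq0.
have wtG c := @grs_weight k n a v c a_inj v_neq0.
have dimC : \dim (mx_code (grs_mx k a v)) = k.
  (* A nonzero [c] in the kernel would have a codeword of weight 0, hence [n < k]. *)
  apply: dim_mx_code => c cG0; apply/eqP/negPn/negP => /wtG.
  rewrite cG0 (eq_card (B := pred0)) => [|j]; last by rewrite !inE mxE eqxx.
  by rewrite card0 addn0 ltnNge le_kn.
have [||d min_d le_d] := @is_min_dist_exists n (mx_code (grs_mx k a v)) (n - k).
- by rewrite dimC.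
(* The weight bound gives [n - k + 1]; only [n - k] is kept. *)
- move=> _ /mx_codeP[c ->] cG0; rewrite leq_subLR; apply/ltnW/wtG.
  by apply: contra_neq cG0 => ->; rewrite mul0mx.
by exists d.
Qed.

(** A hull vector [c *m G] is orthogonal to every row of [G], so [c] is killed by the Gram
    matrix. *)
Lemma hhull_mx_code0 q k n (G : 'M[F]_(k, n)) :
  G *m (map_mx (fun z => z ^+ q) G)^T \in unitmx ->
  \dim (hhull q (mx_code G)) = 0%N.
Proof.
move=> unitG; apply/eqP; rewrite dimv_eq0 -subv0; apply/subvP=> x.
rewrite memv_cap => /andP[/mx_codeP[c ->] /mem_hdual dualx].
suff /(canRL (mulmxK unitG)) -> : c *m (G *m (map_mx (fun z => z ^+ q) G)^T) = 0.
  by rewrite !mul0mx mem0v.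
apply/rowP=> i; rewrite mulmxA !mxE -[RHS](dualx (row i G)).
  by apply: eq_bigr => j _; rewrite !mxE.
by apply/mx_codeP; exists (delta_mx 0 i); rewrite -rowE.
Qed.

(** At most [q + 1] elements are roots of [X ^ (q + 1) - 1], and [q ^ 2 - 1] exceeds [q + 1] once
    [q > 2]. *)
Lemma exists_norm_neq1 q : (2 < q)%N -> #|F| = (q ^ 2)%N ->
  exists2 u : F, u != 0 & u ^+ q.+1 != 1.
Proof.
move=> q_gt2 cardF.
have [/existsP[u /andP[]]|] := boolP [exists u : F, (u != 0) && (u ^+ q.+1 != 1)].
  by exists u.
rewrite negb_exists => /forallP all1.
have : (#|predC1 (0%R : F)| <= q.+1)%N.
  rewrite cardE; apply: max_unity_roots => //; last exact: enum_uniq.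
  apply/allP=> u; rewrite mem_enum !inE => u0; apply/unity_rootP/eqP.
  by have := all1 u; rewrite u0 negbK.
have := cardC1 (0 : F); rewrite cardF => ->.
rewrite -subn1 leq_subLR leqNgt => /negP[].
nia.
Qed.

Lemma exists_row_inj n : (n <= #|F|)%N -> exists a : 'rV[F]_n, injective (a 0).
Proof.
move=> le_nF; exists (\row_j enum_val (widen_ord le_nF j)) => i j.
by rewrite !mxE => /enum_val_inj/(congr1 val) /= eq_ij; apply: val_inj.
Qed.

Lemma grs_lcd q k n (a : 'rV[F]_n) : (2 < q)%N -> #|F| = (q ^ 2)%N ->
    (k <= n)%N -> injective (a 0) ->
  exists2 v : 'rV[F]_n, forall j, v 0 j != 0
    & \dim (hhull q (mx_code (grs_mx k a v))) = 0%N.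
Proof.
move=> q_gt2 cardF le_kn; move: a.
rewrite -(subnKC le_kn); move: (n - k)%N => l {n le_kn} a a_inj.
have [u u_neq0 norm_u] := exists_norm_neq1 q_gt2 cardF.
(* The map is an involution, since [z ^ (q ^ 2) = z] on [F]. *)
have frob_inj : injective (fun z : F => z ^+ q).
  apply: (can_inj (g := fun z => z ^+ q)) => z /=.
  by rewrite -exprM -[(q * q)%N]/(q ^ 2)%N -cardF expf_card.
pose b : 'rV[F]_(k + l) := map_mx (fun z => z ^+ q) a.
pose V1 := Vandermonde k (lsubmx a); pose V2 := Vandermonde k (rsubmx a).
pose W1 := Vandermonde k (lsubmx b); pose W2 := Vandermonde k (rsubmx b).
have uV1 : V1 \in unitmx.
  by apply: unitmx_Vandermonde => i j; rewrite !mxE => /a_inj/lshift_inj.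
have uW1 : W1^T \in unitmx.
  rewrite unitmx_tr.
  by apply: unitmx_Vandermonde => i j; rewrite !mxE => /frob_inj/a_inj/lshift_inj.
(* This matrix is what remains of the second Gram summand after [V1] is factored out on the left and
   [W1^T] on the right. *)
have [d d_1u det_d] :=
  exists_det_add_diag_neq0 (invmx V1 *m (V2 *m W2^T) *m invmx W1^T) norm_u.
(* The first [k] multipliers are preimages of the entries of [d] under the norm [z ^ (q + 1)]; the
   others are 1, so [D2] is the identity. *)
pose v : 'rV[F]_(k + l) := row_mx (\row_i if d 0 i == 1 then 1 else u) (const_mx 1).
have v_neq0 j : v 0 j != 0.
  rewrite mxE; case: splitP => i _; rewrite mxE ?oner_eq0 //.
  by case: ifP => _; rewrite ?oner_eq0.
have norm_v1 i : v 0 (lshift l i) ^+ q.+1 = d 0 i.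
  rewrite row_mxEl mxE; have := d_1u i; rewrite !inE.
  by have [-> _|_] := eqVneq (d 0 i) 1; rewrite ?expr1n ?orbF // => /eqP.
have norm_v2 j : v 0 (rshift k j) ^+ q.+1 = 1.
  by rewrite row_mxEr mxE expr1n.
clearbody v; exists v => //; apply: hhull_mx_code0.
have -> : grs_mx k a v *m (map_mx (fun z => z ^+ q) (grs_mx k a v))^T
        = V1 *m diag_mx d *m W1^T + V2 *m W2^T.
  apply/matrixP=> i j; rewrite [LHS]mxE big_split_ord [RHS]mxE.
  congr (_ + _); rewrite [RHS]mxE; apply: eq_bigr => s _.
    rewrite /grs_mx !mul_mx_diag !mxE -norm_v1 exprS exprMn [in RHS]exprAC.
    by rewrite mulrACA [RHS]mulrAC.
  rewrite /grs_mx !mul_mx_diag !mxE exprMn [in RHS]exprAC mulrACA.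
  by rewrite -exprS norm_v2 mulr1.
have -> : V1 *m diag_mx d *m W1^T + V2 *m W2^T
    = V1 *m (invmx V1 *m (V2 *m W2^T) *m invmx W1^T + diag_mx d) *m W1^T.
  rewrite mulmxDr mulmxDl addrC; congr (_ + _).
  by rewrite !mulmxA mulmxV // mul1mx mulmxKV.
by rewrite !unitmx_mul uV1 uW1 unitmxE unitfE det_d.
Qed.

End ReedSolomon.

Theorem theorem3 (p m q : nat) (hp : prime p) (hm : 0 < m) (hq : q = p ^ m)
    (F : finFieldType) (hF : #|F| = q ^ 2)
    (n k : nat) (hn : 0 < n) (hk : 1 <= k <= n %/ (q + 1))
    (hcond :
      [\/ n - 1 %| q ^ 2 - 1,
          (exists t : nat, n = t * q /\ 1 <= t <= q - 1)
        | (exists t N : nat,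
            [/\ 1 <= N, n = (t + 1) * N + 1, N %| q ^ 2 - 1
              & let n2 := N %/ gcdn N (q + 1) in
                1 <= t <= (q - 1) %/ n2 - 2])])
    (r : nat) (hr : 0 <= r <= k - 1) :
  exists (C : {vspace 'rV[F]_n}) (d : nat),
    [/\ is_code C k d, n - k <= d & 0 <= \dim (hhull q C) <= k - r].
Proof.
have q_gt1 : 1 < q by rewrite hq -(expn0 p) ltn_exp2l // prime_gt1.
have le_nq2 : n <= q ^ 2.
  case: hcond => [/dvdn_leq|[t [-> t_bnd]]|[t [N [N_gt0 -> _ /= t_bnd]]]].
  - by nia.
  - by nia.
  (* Write [N = n2 * g] with [g <= q + 1]. As [t >= 1], the subtraction of 2 is not truncated, so
     [(t + 2) * n2 <= q - 1] and [(t + 2) * N <= q ^ 2 - 1]. *)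
  have g_gt0 : 0 < gcdn N (q + 1) by rewrite gcdn_gt0 N_gt0.
  have le_g : gcdn N (q + 1) <= q + 1 by rewrite dvdn_leq ?dvdn_gcdr ?addn1.
  have NE : N = N %/ gcdn N (q + 1) * gcdn N (q + 1).
    by rewrite divnK ?dvdn_gcdl.
  move: (gcdn _ _) (N %/ _) g_gt0 le_g NE t_bnd => g n2 g_gt0 le_g NE t_bnd.
  have : (q - 1) %/ n2 * n2 <= q - 1 by apply: leq_trunc_div.
  have : (t + 2) * n2 <= (q - 1) %/ n2 * n2 by rewrite leq_mul2r; lia.
  move=> /leq_trans/[apply] le_q; rewrite NE.
  have := leq_mul le_q le_g; nia.
have le_kn : k * (q + 1) <= n by rewrite -leq_divRL ?addn1 //; lia.
have kn : 0 < k <= n by nia.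
have [a a_inj] : exists a : 'rV[F]_n, injective (a 0%R).
  by apply: exists_row_inj; rewrite hF.
suff [v v_neq0 hull_le] : exists2 v : 'rV[F]_n, forall j, v 0%R j != 0%R
    & \dim (hhull q (mx_code (grs_mx k a v))) <= k - r.
  have [d codeC le_d] := grs_is_code kn a_inj v_neq0.
  by exists (mx_code (grs_mx k a v)), d; split.
case: (leqP q 2) => [q_le2|q_gt2].
  (* Here [q = 2], so [3 * k <= n <= 4] forces [k = 1] and [r = 0]; the hull bound is then just
     [\dim C]. *)
  have v_neq0 j : (const_mx 1 : 'rV[F]_n)%R 0%R j != 0%R by rewrite mxE oner_eq0.
  have [d [dimC _] _] := grs_is_code kn a_inj v_neq0.
  exists (const_mx 1%R) => //; apply: leq_trans (dimvS (capvSl _ _)) _.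
  rewrite dimC; nia.
have [|v v_neq0 hull0] := grs_lcd q_gt2 hF _ a_inj (k := k); first by lia.
by exists v; rewrite ?hull0.
Qed.
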